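(* Let $\lambda>0$, let $\nu$ be a non-negative measure on $(0,\infty)$ with $\int_0^\infty (s\wedge 1)\,\nu(ds)<\infty$, let $f(x)=\int_0^\infty (1-e^{-xs})\,\nu(ds)$, and let $N^f(t)$, $t\ge 0$, be the generalized Poisson counting process associated with $(\lambda,\nu)$ (defined in the context). Then for every $t>0$ and every integer $k\ge 0$, $$\Pr\{N^f(t)=k\}=\frac{(-1)^k}{k!}\,\frac{d^k}{du^k}\,e^{-tf(\lambda u)}\Big|_{u=1}.$$
   Context: The generalized Poisson counting process $N^f(t)$, $t\ge0$, associated with $(\lambda,\nu)$ is a non-negative integer-valued process with $N^f(0)=0$, with independent and stationary increments, such that, writing $N^f[t,t+dt)$ for the increment over $[t,t+dt)$, as $dt\downarrow 0$, $$\Pr\{N^f[t,t+dt)=k\}=\begin{cases} dt\,\dfrac{\lambda^k}{k!}\displaystyle\int_0^\infty e^{-\lambda s}s^k\,\nu(ds)+o(dt), & k\ge 1,\\[2mm] 1-dt\displaystyle\int_0^\infty(1-e^{-\lambda s})\,\nu(ds)+o(dt), & k=0.\end{cases}$$ For each $t>0$, $N^f(t)$ has the same law as $N(H^f(t))$, where $N$ is a homogeneous Poisson process of rate $\lambda$ and $H^f$ is an independent subordinator with $\mathbb{E}e^{-\mu H^f(t)}=e^{-tf(\mu)}$. *)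

(* Defs.v *)
From mathcomp Require Import all_boot all_order all_algebra.
From mathcomp Require Import all_classical all_reals all_analysis.

Set Implicit Arguments.
Unset Strict Implicit.
Unset Printing Implicit Defensive.

Import Order.TTheory GRing.Theory Num.Theory.
Import numFieldNormedType.Exports.

Local Open Scope classical_set_scope.
Local Open Scope ring_scope.

(* A measure on (0, +oo) is represented by a Borel measure nu on R that is only
   ever integrated over `]0, +oo[; its mass on ]-oo, 0] plays no role. *)

Definition levy_integrable (R : realType)
    (nu : {measure set (measurableTypeR R) -> \bar R}) : Prop :=
  (\int[nu]_(s in `]0%R, +oo[) (Num.min s 1)%:E < +oo)%E.

Definition bernstein (R : realType)
    (nu : {measure set (measurableTypeR R) -> \bar R}) (x : R) : R :=
  \int[nu]_(s in `]0, +oo[) (1 - expR (- (x * s))).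

Definition jump_rate (R : realType) (lambda : R)
    (nu : {measure set (measurableTypeR R) -> \bar R}) (k : nat) : R :=
  lambda ^+ k / k`!%:R *
    \int[nu]_(s in `]0, +oo[) (expR (- (lambda * s)) * s ^+ k).

Section Process.
Context (d : measure_display) (T : measurableType d) (R : realType)
  (P : probability T R).

(* Only the times t >= 0 are constrained below.  Increments are int-valued:
   subtraction on nat would be truncated. *)
Definition increment (N : R -> {RV P >-> nat}) (s t : R) (w : T) : int :=
  (N t w)%:Z - (N s w)%:Z.

(* Mutual independence of the increments over consecutive intervals.  Increments
   are discrete, so every A i : set int is an admissible event; taking some of
   the A i equal to setT gives the product rule for subfamilies. *)
Definition independent_increments (N : R -> {RV P >-> nat}) : Prop :=
  forall (n : nat) (t : nat -> R) (A : nat -> set int),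
    0 <= t 0%N -> (forall i, (i < n)%N -> t i <= t i.+1) ->
    P [set w | forall i, (i < n)%N -> A i (increment N (t i) (t i.+1) w)] =
    (\prod_(i < n) P [set w | A i (increment N (t i) (t i.+1) w)])%E.

Definition stationary_increments (N : R -> {RV P >-> nat}) : Prop :=
  forall (s t h : R) (A : set int), 0 <= s -> 0 <= t -> 0 <= h ->
    P [set w | A (increment N s (s + h) w)] =
    P [set w | A (increment N t (t + h) w)].

Record generalized_poisson (lambda : R)
    (nu : {measure set (measurableTypeR R) -> \bar R})
    (N : R -> {RV P >-> nat}) : Prop := GeneralizedPoisson {
  gp_start : {ae P, forall w, N 0 w = 0%N} ;
  gp_independent : independent_increments N ;
  gp_stationary : stationary_increments N ;
  gp_jump : forall (t : R) (k : nat), 0 <= t -> (1 <= k)%N ->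
    (fun h : R => fine (P [set w | increment N t (t + h) w = k%:Z])) =
    (fun h : R => h * jump_rate lambda nu k) +o_ (0^'+) (fun h : R => h) ;
  gp_no_jump : forall t : R, 0 <= t ->
    (fun h : R => fine (P [set w | increment N t (t + h) w = 0])) =
    (fun h : R => 1 - h * bernstein nu lambda) +o_ (0^'+) (fun h : R => h)
}.

End Process.

(* Main.v *)
Require Import Defs.
From mathcomp Require Import all_boot all_order all_algebra.
From mathcomp Require Import all_classical all_reals all_analysis.
From mathcomp Require Import measurable_realfun ring lra.

(** Let q_t(k) be the probability that N_t = k.  Independence and stationarity
    of the increments make q a convolution semigroup on the natural numbers
    (count_law_semigroup), and its derivative at t = 0 is the sequence L with
    L_0 = - f(lambda) and L_k the jump rate of size k
    (generalized_poisson_generator).  So the generating function of q_t is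
    exp (t L(x)) with L(x) = \sum_k L_k x^k.  This is used in coefficientwise
    form: q_t(0) = exp (t L_0) (semigroup_expR), and the remaining values are
    determined by the recursion
      (k + 1) q_t(k + 1) = t \sum_(i <= k) q_t(i) (k - i + 1) L_(k - i + 1)
    expressing that the derivative in x of exp (t L) is t L' exp (t L)
    (semigroup_exp_recursion).

    On the other side, differentiating f under the integral sign shows that
    L_k = (-1)^k / k! times the k-th derivative at u = 1 of u |-> - f(lambda u)
    (taylor_family_levy); in other words L(x) = - f(lambda (1 - x)).  The
    sequence (-1)^k / k! * g^(k)(1), with g(u) = exp (- t f(lambda u)), starts
    with the same value g(1) = exp (t L_0) and, by the Leibniz rule, obeys the
    same recursion (taylor_family_exp).  Hence the two sequences coincide
    (exp_recursion_unique). *)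

Set Implicit Arguments.
Unset Strict Implicit.
Unset Printing Implicit Defensive.

Import Order.TTheory GRing.Theory Num.Theory.
Import numFieldNormedType.Exports.

Local Open Scope classical_set_scope.
Local Open Scope ring_scope.

(** * Convolution semigroups on the natural numbers *)

Section convolution_semigroups.
Context {R : realType}.
Implicit Types (L c : nat -> R) (q : R -> nat -> R).

(** With x a formal variable, this is the coefficientwise form of
    c' = t L' c, the differential equation in x that characterises
    c(x) = c(0) exp (t (L(x) - L(0))) among power series. *)
Definition exp_recursion (t : R) L c : Prop := forall k : nat,
  k.+1%:R * c k.+1 =
  t * \sum_(i < k.+1) c i * ((k - i).+1%:R * L (k - i).+1).

Lemma exp_recursion_unique t L c c' :
  exp_recursion t L c -> exp_recursion t L c' -> c 0%N = c' 0%N -> c =1 c'.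
Proof.
move=> rc rc' c0; elim/ltn_ind => -[//|k IH].
have k0 : k.+1%:R != 0 :> R by rewrite pnatr_eq0.
apply: (mulfI k0); rewrite rc rc'; congr (_ * _).
by apply: eq_bigr => i _; rewrite IH.
Qed.

Definition convolution_semigroup q : Prop := forall s t k, 0 <= s -> 0 <= t ->
  q (s + t) k = \sum_(i < k.+1) q s i * q t (k - i)%N.

(** The subtracted term is the unit mass at 0, which is the law at time 0. *)
Definition generator L q : Prop := forall k,
  h^-1 * (q h k - (k == 0%N)%:R) @[h --> 0^'+] --> L k.

(** Coefficients of index below K of a product only involve coefficients of
    index below K, so truncating the generating function is harmless and the
    convolution powers become powers of a polynomial. *)
Lemma semigroup_poly_expn q (h : R) (K n : nat) :
  convolution_semigroup q -> (forall k, q 0 k = (k == 0%N)%:R) -> 0 <= h ->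
  forall k, (k < K)%N -> ((\poly_(i < K) q h i) ^+ n)`_k = q (n%:R * h) k.
Proof.
move=> semi q0 h0; elim: n => [|n IH] k kK.
  by rewrite expr0 mul0r q0 coef1.
rewrite exprSr coefM -natr1 mulrDl mul1r semi ?mulr_ge0//.
apply: eq_bigr => i _; rewrite IH ?coef_poly; last first.
  by rewrite (leq_ltn_trans _ kK)// -ltnS.
by rewrite (leq_ltn_trans (leq_subr _ _) kK).
Qed.

Lemma cvg0_of_rate (x : nat -> R) (a : R) :
  n.+1%:R * x n @[n --> \oo] --> a -> x n @[n --> \oo] --> (0 : R).
Proof.
move=> xa; have : harmonic n * (n.+1%:R * x n) @[n --> \oo] --> 0 * a.
  by apply: cvgM => //; exact: cvg_harmonic.
rewrite mul0r; apply: cvg_trans; apply: near_eq_cvg; apply: nearW => n /=.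
by rewrite mulrA mulVf ?mul1r.
Qed.

(** The generator read along the subdivision of [0, t] into n + 1 steps. *)
Lemma generator_seq L q (t : R) : 0 < t -> generator L q -> forall k,
  n.+1%:R * (q (t / n.+1%:R) k - (k == 0%N)%:R) @[n --> \oo] --> t * L k.
Proof.
move=> t0 gen k.
have /cvg_at_rightP/(_ (fun n => t / n.+1%:R)) := gen k.
have st : (forall n, 0 < t / n.+1%:R :> R) /\ t / n.+1%:R @[n --> \oo] --> (0 : R).
  split=> [n|]; first by rewrite divr_gt0.
  rewrite -(mulr0 t); apply: cvgMl_tmp; exact: cvg_harmonic.
move=> /(_ st) /(cvgM (cvg_cst t)).
apply: cvg_trans; apply: near_eq_cvg; apply: nearW => n /=.
by rewrite invf_div mulrA (mulrC t) divfK ?lt0r_neq0.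
Qed.
Arguments generator_seq {L q t}.

Lemma generator_seq0 L q (t : R) : 0 < t -> generator L q -> forall k,
  q (t / n.+1%:R) k @[n --> \oo] --> ((k == 0%N)%:R : R).
Proof.
move=> t0 gen k; apply/subr_cvg0; exact: cvg0_of_rate (generator_seq t0 gen k).
Qed.
Arguments generator_seq0 {L q t}.

Lemma cvg_sum_seq (n : nat) (f : 'I_n -> nat -> R) (a : 'I_n -> R) :
  (forall i, f i m @[m --> \oo] --> a i) ->
  \sum_i f i m @[m --> \oo] --> \sum_i a i.
Proof.
by move=> fa; apply: cvg_big => [|i _]; [exact: add_continuous|exact: fa].
Qed.

(** Let Q be the truncated generating function of the law at time t / n.
    Up to truncation, Q ^ n is the one at time t, so that the identity
    Q * (Q ^ n)' = Q ^ n * (n Q') of formal derivatives relates time t to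
    time t / n.  As n grows, Q tends to 1 and n Q' to t L', which leaves
    q_t' = t L' q_t: no differential equation in t has to be solved. *)
Lemma semigroup_exp_recursion L q (t : R) :
  convolution_semigroup q -> (forall k, q 0 k = (k == 0%N)%:R) ->
  generator L q -> 0 < t -> exp_recursion t L (q t).
Proof.
move=> semi q0 gen t0 k.
pose Q (n : nat) := \poly_(i < k.+2) q (t / n.+1%:R) i.
have h0 n : 0 <= t / n.+1%:R :> R by rewrite divr_ge0// ltW.
have Qt n i : (i < k.+2)%N -> (Q n ^+ n.+1)`_i = q t i.
  move=> ik; rewrite semigroup_poly_expn//.
  by rewrite mulrCA divff ?mulr1.
(* Coefficient k of Q * (Q ^ n)' = Q ^ n * (n Q'), with n.+1 for n: it involves
   coefficients of Q ^ n of index up to k.+1, hence the truncation at k.+2. *)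
have key n : \sum_(j < k.+1) q (t / n.+1%:R) j * (q t (k - j).+1 *+ (k - j).+1)
   = \sum_(j < k.+1) q t j * ((k - j).+1%:R * (n.+1%:R * q (t / n.+1%:R) (k - j).+1)).
  have : (Q n * (Q n ^+ n.+1)^`())`_k = (Q n ^+ n.+1 * (Q n)^`() *+ n.+1)`_k.
    by rewrite deriv_exp mulrnAr mulrCA -exprS mulrC.
  rewrite coefM coefMn coefM => e.
  transitivity (\sum_(j < k.+1) (Q n)`_j * ((Q n ^+ n.+1)^`())`_(k - j)).
    apply: eq_bigr => j _; rewrite coef_deriv Qt ?coef_poly.
      by rewrite (ltn_trans (ltn_ord j)).
    by rewrite !ltnS leq_subr.
  rewrite e -sumrMnl; apply: eq_bigr => j _.
  rewrite Qt ?(ltn_trans (ltn_ord j))// coef_deriv coef_poly !ltnS leq_subr.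
  by rewrite !mulr_natl !mulrnAr mulrnAC.
have l1 : \sum_(j < k.+1) q (t / n.+1%:R) j * (q t (k - j).+1 *+ (k - j).+1)
    @[n --> \oo] --> k.+1%:R * q t k.+1.
  rewrite [X in _ --> X](_ : _ = \sum_(j < k.+1)
     ((j : nat) == 0%N)%:R * (q t (k - j).+1 *+ (k - j).+1)).
    apply: cvg_sum_seq => j.
    by apply: cvgMr_tmp; exact: generator_seq0.
  rewrite big_ord_recl big1 ?addr0/= ?mul1r ?subn0 ?mulr_natl//.
  by move=> i _; rewrite mul0r.
have l2 : \sum_(j < k.+1) q t j *
     ((k - j).+1%:R * (n.+1%:R * q (t / n.+1%:R) (k - j).+1)) @[n --> \oo] -->
   \sum_(j < k.+1) q t j * ((k - j).+1%:R * (t * L (k - j).+1)).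
  apply: cvg_sum_seq => j.
  apply: cvgMl_tmp; apply: cvgMl_tmp.
  have := generator_seq t0 gen (k - j).+1.
  by under eq_fun do rewrite subr0.
rewrite mulr_sumr.
under eq_bigr do rewrite mulrCA (mulrCA t).
move: l1; under eq_fun do rewrite key.
by move=> l1; apply: cvg_unique l1 l2.
Qed.

(** The bounds exp (1 - 1 / y) <= y <= exp (y - 1) for y > 0, both instances
    of 1 + z <= exp z, squeeze the powers. *)
Lemma cvg_expn_expR (x : nat -> R) (a : R) :
  n.+1%:R * (x n - 1) @[n --> \oo] --> a ->
  x n ^+ n.+1 @[n --> \oo] --> expR a.
Proof.
move=> xa.
have x1 : x n @[n --> \oo] --> (1 : R).
  apply/subr_cvg0; exact: cvg0_of_rate xa.
have up : expR (n.+1%:R * (x n - 1)) @[n --> \oo] --> expR a.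
  by apply: continuous_cvg xa; exact: continuous_expR.
have lo : expR (n.+1%:R * (x n - 1) * (x n)^-1) @[n --> \oo] --> expR a.
  apply: continuous_cvg; first exact: continuous_expR.
  have -> : a = a * 1^-1 by rewrite invr1 mulr1.
  by apply: cvgM => //; apply: cvgV => //; exact: oner_neq0.
apply: squeeze_cvgr lo up.
have : \forall n \near \oo, 0 < x n by apply: (cvgr_gt 1).
apply: filterS => n xn0; apply/andP; split.
  rewrite -mulrA expRM_natl.
  rewrite lerXn2r ?nnegrE ?expR_ge0//.
    exact: ltW.
  rewrite -[leRHS]invrK -[leLHS]invrK -expRN lef_pV2 ?posrE ?expR_gt0 ?invr_gt0//.
  apply: le_trans (expR_ge1Dx _).
  rewrite mulrBl divff ?gt_eqF// mul1r; lra.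
rewrite expRM_natl lerXn2r ?nnegrE ?expR_ge0//; first exact: ltW.
apply: le_trans (expR_ge1Dx _); lra.
Qed.

Lemma semigroup_expR L q (t : R) :
  convolution_semigroup q -> (forall k, q 0 k = (k == 0%N)%:R) ->
  generator L q -> 0 < t -> q t 0%N = expR (t * L 0%N).
Proof.
move=> semi q0 gen t0.
have powq n (h : R) : 0 <= h -> q (n%:R * h) 0%N = q h 0%N ^+ n.
  move=> h0; elim: n => [|n IH]; first by rewrite mul0r q0 expr0.
  rewrite -natr1 mulrDl mul1r semi ?mulr_ge0//.
  by rewrite big_ord_recl big_ord0 addr0 IH exprSr.
have := cvg_expn_expR (generator_seq t0 gen 0%N).
apply: cvg_unique => //.
rewrite [X in X @ _](_ : _ = fun=> q t 0%N); first exact: cvg_cst.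
apply/funext => n; rewrite -powq ?divr_ge0 ?ltW//.
by rewrite mulrCA divff ?mulr1.
Qed.

End convolution_semigroups.

(** * Scaled derivatives of an exponential *)

Section scaled_derivatives.
Context {R : realType}.

(** The normalisation satisfied by L_j = (-1)^j / j! times the j-th derivative
    of L_0, i.e. by the coefficients of x^j in the Taylor expansion of
    L_0 (u - x). *)
Definition taylor_family (L : nat -> R -> R) : Prop :=
  forall (j : nat) (u : R), 0 < u -> is_derive u 1 (L j) (- (j.+1%:R * L j.+1 u)).

(** Leibniz rule for the scaled derivatives: up to sign, the left-hand side is
    the derivative of \sum_i c_i M_(k-i) when c_i and M_i have derivatives
    -(i+1) c_(i+1) and -(i+1) M_(i+1).  Shifting the index in the first half
    makes the two halves add up, since i + (k + 1 - i) = k + 1. *)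
Lemma leibniz_shift (c M : nat -> R) (k : nat) :
  \sum_(i < k.+1) (i.+1%:R * c i.+1 * M (k - i)%N +
                   c i * ((k - i).+1%:R * M (k - i).+1)) =
  k.+1%:R * \sum_(i < k.+2) c i * M (k.+1 - i)%N.
Proof.
rewrite big_split/=.
have -> : \sum_(i < k.+1) i.+1%:R * c i.+1 * M (k - i)%N =
    \sum_(i < k.+2) i%:R * c i * M (k.+1 - i)%N.
  by rewrite [RHS]big_ord_recl !mul0r add0r; apply: eq_bigr.
have -> : \sum_(i < k.+1) c i * ((k - i).+1%:R * M (k - i).+1) =
    \sum_(i < k.+2) c i * ((k.+1 - i)%:R * M (k.+1 - i)%N).
  rewrite [RHS]big_ord_recr/= subnn mul0r mulr0 addr0; apply: eq_bigr => i _.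
  by rewrite subSn// -ltnS.
rewrite -big_split mulr_sumr; apply: eq_bigr => i _ /=.
rewrite natrB; last by rewrite -ltnS.
ring.
Qed.

(** By strong induction on k: the recursion at all indices below k writes the
    k-th scaled derivative as a polynomial in earlier ones and in the L_j, all
    known to be differentiable; differentiating this expression with
    leibniz_shift gives the recursion at k. *)
Lemma taylor_family_exp (L : nat -> R -> R) (t : R) :
  taylor_family L ->
  let g := fun u => expR (t * L 0%N u) in
  let c := fun k u => (-1) ^+ k / k`!%:R * derive1n k g u in
  forall (k : nat) (u : R), 0 < u -> derivable (derive1n k g) u 1 /\
   k.+1%:R * c k.+1 u =
   t * \sum_(i < k.+1) c i u * ((k - i).+1%:R * L (k - i).+1 u).
Proof.
move=> dL g c.
have factN0 k : k`!%:R != 0 :> R by rewrite pnatr_eq0 -lt0n fact_gt0.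
have gE k : derive1n k g = fun u => (-1) ^+ k * k`!%:R * c k u.
  by apply/funext => u; rewrite /c mulrACA signrMK mulrA mulVf ?mul1r //.
have dc (k : nat) (u D : R) : is_derive u 1 (c k) D ->
    derivable (derive1n k g) u 1 /\ k.+1%:R * c k.+1 u = - D.
  move=> cD; have dg : is_derive u 1 (derive1n k g) ((-1) ^+ k * k`!%:R * D).
    by rewrite gE; apply: is_deriveZ.
  split; first by case: dg.
  have -> : c k.+1 u = (-1) ^+ k.+1 / k.+1`!%:R * ((-1) ^+ k * k`!%:R * D).
    by rewrite /c derive1nS derive1E derive_val.
  have : (-1) ^+ k * (-1) ^+ k = 1 :> R by rewrite -exprMn mulrNN mulr1 expr1n.
  rewrite factS natrM exprS; move: ((-1)^+k) => e e2.
  have -> : k.+1%:R * (-1 * e / (k.+1%:R * k`!%:R) * (e * k`!%:R * D)) =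
    - (e * e) * D by field; rewrite factN0 nat1r pnatr_eq0.
  by rewrite e2 mulN1r.
elim/ltn_ind => k IH u u0.
suff H : is_derive u 1 (c k)
   (- (t * \sum_(i < k.+1) c i u * ((k - i).+1%:R * L (k - i).+1 u))).
  by have [dk ->] := dc _ _ _ H; rewrite opprK.
case: k IH => [|k] IH.
  have cg v : c 0%N v = g v by rewrite /c fact0 divr1 mul1r.
  have -> : c 0%N = g by apply/funext.
  rewrite big_ord1 /= cg.
  have dtL : is_derive u 1 (fun v : R => t * L 0%N v) (t * - (1 * L 1%N u)).
    exact: (is_deriveZ t (dL 0%N u u0)).
  have /is_derive_eq := @is_derive1_comp _ expR _ _ _ _ (is_derive_expR _) dtL; apply.
  by rewrite subn0 /g; ring.
have rc v : 0 < v -> c k.+1 v =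
    t / k.+1%:R * \sum_(i < k.+1) c i v * ((k - i).+1%:R * L (k - i).+1 v).
  move=> v0; have [_ r] := IH k (ltnSn k) v v0.
  by rewrite mulrAC -r mulrC mulKf ?pnatr_eq0.
have cD i : (i <= k)%N -> is_derive u 1 (c i) (- (i.+1%:R * c i.+1 u)).
  move=> ik; have [di _] := IH i ik u u0.
  have gD : is_derive u 1 (derive1n i g) (derive1n i.+1 g u).
    by rewrite derive1nS derive1E; apply: DeriveDef.
  have := is_deriveZ ((-1) ^+ i / i`!%:R) gD.
  move/is_derive_eq; apply.
  rewrite /c factS natrM exprS /GRing.scale/=; field.
  by rewrite factN0 nat1r pnatr_eq0.
pose M j u := j.+1%:R * L j.+1 u.
have MD j : is_derive u 1 (M j) (- (j.+1%:R * M j.+1 u)).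
  have /is_derive_eq := is_deriveZ j.+1%:R (dL j.+1 u u0); apply.
  by rewrite /M /GRing.scale/=; ring.
(* Differentiate the recursion rc, valid in a neighbourhood of u. *)
have SD : is_derive u 1 (fun v => \sum_(i < k.+1) c i v * M (k - i)%N v)
   (- (k.+1%:R * \sum_(i < k.+2) c i u * M (k.+1 - i)%N u)).
  rewrite -(leibniz_shift (c^~ u) (M^~ u)) -sumrN.
  have := @is_derive_sum _ _ _ k.+1 (fun i => c i * M (k - i)%N) u 1 _
    (fun i => is_deriveM (cD i (ltn_ord i)) (MD (k - i)%N)).
  rewrite (_ : \sum_i _ = fun v => \sum_(i < k.+1) c i v * M (k - i)%N v).
    move/is_derive_eq; apply; apply: eq_bigr => i _.
    by rewrite /GRing.scale/=; ring.
  by apply/funext => v; rewrite fct_sumE.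
have := is_deriveZ (t / k.+1%:R) SD.
rewrite (_ : _ *: _ = - (t * \sum_(i < k.+2) c i u * M (k.+1 - i)%N u)); last first.
  by rewrite /GRing.scale/=; field; rewrite nat1r pnatr_eq0.
apply: near_eq_is_derive.
near=> v; apply/esym/rc.
near: v; exact: lt_nbhsr.
Unshelve. all: end_near.
Qed.

End scaled_derivatives.

(** * Derivatives of the Laplace exponent *)

Section laplace_exponent.
Context {R : realType} (nu : {measure set (measurableTypeR R) -> \bar R}).
Hypothesis nu_levy : levy_integrable nu.

(** The function s |-> min(s, 1) is the universal dominating function: every
    integrand below is compared with a multiple of it. *)
Lemma levy_dominated (f : R -> R) (C : R) :
  measurable_fun (`]0, +oo[ : set (measurableTypeR R)) f ->
  (forall s : R, 0 < s -> `|f s| <= C * Num.min s 1) ->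
  nu.-integrable `]0, +oo[ (EFin \o f).
Proof.
move=> mf fC.
have mI : measurable (`]0%R, +oo[ : set (measurableTypeR R)) by exact: measurable_itv.
have mmin : measurable_fun (`]0%R, +oo[ : set (measurableTypeR R)) (fun s : R => Num.min s 1).
  by apply: measurable_minr => //; exact: measurable_cst.
have imin : nu.-integrable `]0, +oo[ (EFin \o (fun s => Num.min s 1)).
  apply/integrableP; split; first exact/measurable_EFinP.
  apply: le_lt_trans nu_levy; apply: ge0_le_integral => //.
  - by apply/measurable_EFinP; apply: measurableT_comp.
  - exact/measurable_EFinP.
  - move=> s; rewrite /= in_itv/= andbT => s0.
    by rewrite lee_fin ger0_norm// le_min ltW//= ler01.
apply: (@le_integrable _ _ _ nu _ mI _ (EFin \o (fun s => C * Num.min s 1))).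
- exact/measurable_EFinP.
- move=> s; rewrite /= in_itv/= andbT => s0; rewrite lee_fin.
  by rewrite (le_trans (fC _ s0))// ler_norm.
- have := integrableZl mI C imin; congr (integrable _ _ _).
Qed.

(** Only a lower bound on x is asked for in the domination, because the
    exponentials exp(- x s) to be dominated are largest for small x. *)
Lemma is_derive_Rintegral (f f' : R -> R -> R) (C a : R) : 0 < a ->
  (forall x s : R, 0 < x -> 0 < s -> is_derive x 1 (f^~ s) (f' x s)) ->
  (forall x : R, 0 < x -> nu.-integrable `]0, +oo[ (EFin \o f x)) ->
  0 <= C -> (forall x s : R, a / 2 < x -> 0 < s -> `|f' x s| <= C * Num.min s 1) ->
  is_derive a 1 (fun x => \int[nu]_(s in `]0, +oo[) f x s)
    (\int[nu]_(s in `]0, +oo[) f' a s).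
Proof.
move=> a0 df intf C0 f'C.
have mI : measurable (`]0%R, +oo[ : set (measurableTypeR R)) by exact: measurable_itv.
have Ia : `]a / 2, a + 1[%classic a by rewrite /= in_itv/=; apply/andP; split; lra.
have pos x : `]a / 2, a + 1[%classic x -> 0 < x.
  by rewrite /= in_itv/= => /andP[? _]; lra.
have intf1 x : `]a / 2, a + 1[%classic x ->
    nu.-integrable `]0, +oo[ (EFin \o f x).
  by move=> /pos; exact: intf.
have derf1 x s : `]a / 2, a + 1[%classic x -> `]0, +oo[%classic s ->
    derivable (f^~ s) x 1.
  by move=> /pos x0; rewrite /= in_itv/= andbT => s0; case: (df _ _ x0 s0).
(* The dominating function has to be nonnegative on all of R. *)
pose G s := C * `|Num.min s 1|.
have G0 s : 0 <= G s by rewrite /G mulr_ge0.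
have intG : nu.-integrable `]0, +oo[ (EFin \o G).
  apply: (@levy_dominated _ C).
    apply: measurable_funM; first exact: measurable_cst.
    apply: measurableT_comp => //; apply: measurable_minr => //; exact: measurable_cst.
  move=> s s0; have m0 : 0 <= Num.min s 1 by rewrite le_min ltW//= ler01.
  by rewrite /G (ger0_norm m0) ger0_norm// mulr_ge0.
have Gub x s : `]a / 2, a + 1[%classic x -> `]0, +oo[%classic s ->
    `|partial1of2 f x s| <= G s.
  move=> xI; rewrite /= in_itv/= andbT => s0.
  rewrite partial1of2E; have d := df _ _ (pos _ xI) s0; rewrite derive_val.
  apply: le_trans (f'C _ _ _ s0) _.
    by move: xI; rewrite /= in_itv/= => /andP[].
  by rewrite ler_wpM2l// ler_norm.
apply: DeriveDef.
  exact: (derivable_under_integral mI Ia intf1 derf1 G0 intG Gub).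
rewrite -derive1E (differentiation_under_integral mI Ia intf1 derf1 G0 intG Gub).
apply: eq_Rintegral => s; rewrite inE/= in_itv/= andbT => s0.
by rewrite partial1of2E; have d := df _ _ a0 s0; rewrite derive_val.
Qed.

(** For s <= 1 a factor s is kept and the rest is at most 1; for s > 1 the
    term of order k + 1 of the exponential series gives
    (a s)^(k+1) / (k+1)! <= exp(a s). *)
Lemma expR_moment_bound (k : nat) (a s : R) : 0 < a -> 0 < s ->
  expR (- (a * s)) * s ^+ k.+1 <= (1 + k.+1`!%:R / a ^+ k.+1) * Num.min s 1.
Proof.
move=> a0 s0.
have C0 : 0 <= k.+1`!%:R / a ^+ k.+1 by rewrite divr_ge0// exprn_ge0// ltW.
have [s1|s1] := leP s 1.
  rewrite exprS mulrA -[leRHS]mulr1 ler_pM//.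
  - by rewrite mulr_ge0 ?expR_ge0// ltW.
  - by rewrite exprn_ge0// ltW.
  - rewrite ler_wpM2r ?(ltW s0)//.
    apply: (@le_trans _ _ 1); last lra.
    by rewrite -[leRHS]expR0 ler_expR oppr_le0 ltW// mulr_gt0.
  - by rewrite exprn_ile1// ltW.
rewrite mulr1 (@le_trans _ _ (k.+1`!%:R / a ^+ k.+1))//; last lra.
rewrite expRN ler_pdivlMr ?exprn_gt0// -mulrA -exprMn (mulrC s).
rewrite [leLHS]mulrC ler_pdivrMr ?expR_gt0// [leRHS]mulrC -ler_pdivrMr ?ltr0n ?fact_gt0//.
apply: le_trans (expR_ge1Dxn k _); first lra.
by rewrite mulr_ge0// ltW.
Qed.

Definition laplace_moment (k : nat) (x : R) : R :=
  \int[nu]_(s in `]0, +oo[) (expR (- (x * s)) * s ^+ k).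

Lemma integrable_laplace_moment (k : nat) (x : R) : 0 < x ->
  nu.-integrable `]0, +oo[ (EFin \o fun s => expR (- (x * s)) * s ^+ k.+1).
Proof.
move=> x0; apply: (@levy_dominated _ (1 + k.+1`!%:R / x ^+ k.+1)).
  apply: measurable_funM; last exact: exprn_measurable.
  apply: measurableT_comp => //.
  by apply: measurableT_comp => //; apply: measurable_funM.
move=> s s0; rewrite ger0_norm; first exact: expR_moment_bound.
by rewrite mulr_ge0 ?expR_ge0// exprn_ge0// ltW.
Qed.

Lemma is_derive_expRM (x s : R) :
  is_derive x 1 (fun x => expR (- (x * s))) (- (expR (- (x * s)) * s)).
Proof.
have H : is_derive x 1 (fun y : R => - (y * s)) (- s).
  by apply: is_derive_eq; rewrite ?scaler0 ?addr0 ?add0r; congr (- _); rewrite /GRing.scale/= mulr1.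
have /is_derive_eq := @is_derive1_comp _ expR _ _ _ _ (is_derive_expR _) H; apply.
by rewrite mulrN.
Qed.

Lemma expR_deriv_bound (k : nat) (a x s : R) : 0 < a -> a / 2 < x -> 0 < s ->
  `|expR (- (x * s)) * s ^+ k.+1| <=
  (1 + k.+1`!%:R / (a / 2) ^+ k.+1) * Num.min s 1.
Proof.
move=> a0 ax s0; rewrite ger0_norm; last first.
  by rewrite mulr_ge0 ?expR_ge0// exprn_ge0// ltW.
apply: le_trans (expR_moment_bound k _ s0); last lra.
rewrite ler_wpM2r ?exprn_ge0 ?(ltW s0)// ler_expR lerN2 ler_wpM2r//; exact: ltW.
Qed.

Lemma is_derive_laplace_moment (k : nat) (x : R) : 0 < x ->
  is_derive x 1 (laplace_moment k.+1) (- laplace_moment k.+2 x).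
Proof.
move=> x0; have x20 : 0 < x / 2 by rewrite divr_gt0.
have -> : - laplace_moment k.+2 x =
    \int[nu]_(s in `]0, +oo[) (- (expR (- (x * s)) * s ^+ k.+2)).
  rewrite -mulN1r -RintegralZl//; last exact: integrable_laplace_moment.
  by apply: eq_Rintegral => s _; rewrite mulN1r.
apply: (@is_derive_Rintegral (fun x s => expR (- (x * s)) * s ^+ k.+1)
  (fun x s => - (expR (- (x * s)) * s ^+ k.+2))
  (1 + k.+2`!%:R / (x / 2) ^+ k.+2)) => //.
- move=> y s y0 s0.
  have /is_derive_eq := is_deriveZ (s ^+ k.+1) (is_derive_expRM y s).
  rewrite (_ : _ \*: _ = fun x => expR (- (x * s)) * s ^+ k.+1); last first.
    by apply/funext => z; rewrite /= /GRing.scale/= mulrC.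
  by apply; rewrite /GRing.scale/= [in RHS]exprS; ring.
- by move=> y y0; exact: integrable_laplace_moment.
- by rewrite addr_ge0// divr_ge0// exprn_ge0// ltW.
- by move=> y s xy s0; rewrite normrN; exact: expR_deriv_bound.
Qed.

Lemma is_derive_bernstein (x : R) : 0 < x ->
  is_derive x 1 (bernstein nu) (laplace_moment 1 x).
Proof.
move=> x0; have x20 : 0 < x / 2 by rewrite divr_gt0.
apply: (@is_derive_Rintegral (fun x s => 1 - expR (- (x * s)))
  (fun x s => expR (- (x * s)) * s ^+ 1)
  (1 + 1`!%:R / (x / 2) ^+ 1)) => //.
- move=> y s y0 s0.
  have /is_derive_eq := is_deriveB (is_derive_cst (1 : R) y 1) (is_derive_expRM y s).
  by apply; rewrite sub0r opprK.
- move=> y y0; apply: (@levy_dominated _ (1 + y)).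
    apply: measurable_funB => //; apply: measurableT_comp => //.
    by apply: measurableT_comp => //; apply: measurable_funM.
  move=> s s0.
  have e1 : expR (- (y * s)) <= 1.
    by rewrite -[leRHS]expR0 ler_expR oppr_le0 ltW// mulr_gt0.
  rewrite ger0_norm ?subr_ge0//.
  have [s1|s1] := leP s 1.
    have := expR_ge1Dx (- (y * s)); nra.
  have := expR_ge0 (- (y * s)); lra.
- by rewrite addr_ge0// divr_ge0// exprn_ge0// ltW.
- by move=> y s xy s0; exact: expR_deriv_bound.
Qed.

(** Scaled derivatives of u |-> - f(lambda u); the factors (-1)^k cancel against
    the signs produced by differentiating exp(- lambda u s), so that the terms
    with k > 0 at u = 1 are the jump rates. *)
Definition levy_taylor (lambda : R) (k : nat) (u : R) : R :=
  if k is 0 then - bernstein nu (lambda * u)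
  else lambda ^+ k / k`!%:R * laplace_moment k (lambda * u).

Lemma taylor_family_levy (lambda : R) : 0 < lambda ->
  taylor_family (levy_taylor lambda).
Proof.
move=> l0 j u u0; have lu0 : 0 < lambda * u by rewrite mulr_gt0.
have dl : is_derive u 1 ( *%R lambda) lambda.
  have /is_derive_eq := is_deriveZ lambda (@is_derive_id _ _ u (1 : R)); apply.
  by rewrite /GRing.scale/= mulr1.
case: j => [|j].
  have d := @is_derive1_comp _ (bernstein nu) _ _ _ _ (is_derive_bernstein lu0) dl.
  have /is_derive_eq := is_deriveN d; apply.
  by rewrite /levy_taylor expr1 divr1; ring.
have d := @is_derive1_comp _ (laplace_moment j.+1) _ _ _ _ (is_derive_laplace_moment j lu0) dl.
have /is_derive_eq := is_deriveZ (lambda ^+ j.+1 / j.+1`!%:R) d; apply.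
rewrite /levy_taylor [in RHS]factS natrM [in RHS]exprS /GRing.scale/=.
field.
by rewrite -natrD !pnatr_eq0 -lt0n fact_gt0.
Qed.

End laplace_exponent.

(** * The law of the counting process *)

Section counting_process.
Context (d : measure_display) (T : measurableType d) (R : realType)
  (P : probability T R) (N : R -> {RV P >-> nat}).

(** Conditioning on the first of the two counts writes the event as a countable
    union. *)
Lemma measurable_increment (A : set int) (s t : R) :
  measurable [set w | A (increment N s t w)].
Proof.
rewrite (_ : [set w | _] = \bigcup_i (N s @^-1` [set i] `&`
    N t @^-1` [set j | A (j%:Z - i%:Z)])).
  apply: bigcup_measurable => i _; apply: measurableI;
  by rewrite -[X in measurable X]setTI; apply: measurable_funPT.
apply/seteqP; split => [w Aw|w [i _] [/= Ni]]; last by rewrite /increment Ni.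
by exists (N s w).
Qed.

(** Used to discard the event where the process does not start at 0 or has a
    negative increment. *)
Lemma measure_eq_mod0 (A B Z : set T) : measurable A -> measurable B ->
  measurable Z -> P Z = 0%E -> A `|` Z = B `|` Z -> P A = P B.
Proof.
move=> mA mB mZ Z0 AB.
by rewrite -(measureU0 mA mZ Z0) AB (measureU0 mB mZ Z0).
Qed.

Definition count_law (t : R) (k : nat) : R :=
  fine (P [set w | increment N 0 t w = k%:Z]).

Lemma count_lawE (t : R) (k : nat) :
  (count_law t k)%:E = P [set w | increment N 0 t w = k%:Z].
Proof.
rewrite /count_law fineK// fin_num_measure//.
exact: (measurable_increment [set k%:Z]).
Qed.

Section start.
Hypothesis N0 : {ae P, forall w, N 0 w = 0%N}.

Lemma count_lawP (t : R) (k : nat) :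
  P [set w | N t w = k] = (count_law t k)%:E.
Proof.
have [Z [mZ Z0 NZ]] := N0.
rewrite count_lawE; apply: (measure_eq_mod0 _ _ mZ Z0).
- rewrite -[X in measurable X]/(N t @^-1` [set k]) -[X in measurable X]setTI.
  exact: measurable_funPT.
- exact: (measurable_increment [set k%:Z]).
- apply/seteqP; split => w [/= H|]; try by right.
    have [e|e] := eqVneq (N 0 w) 0%N; last by right; apply: NZ => /= /eqP; rewrite (negbTE e).
    by left; rewrite /= /increment e H subr0.
  have [e|e] := eqVneq (N 0 w) 0%N; last by right; apply: NZ => /= /eqP; rewrite (negbTE e).
  by left; move: H; rewrite /increment e subr0 => -[].
Qed.

Lemma count_law0 (k : nat) : count_law 0 k = (k == 0%N)%:R.
Proof.
rewrite /count_law; have [->|k0] := eqVneq k 0%N.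
  rewrite (_ : [set w | _] = setT) ?probability_setT//.
  by apply/seteqP; split => w //= _; rewrite /increment subrr.
rewrite (_ : [set w | _] = set0) ?measure0//.
apply/seteqP; split => w //=; rewrite /increment subrr => -[/esym /eqP].
by rewrite (negbTE k0).
Qed.

(** A process that starts at 0 and takes values in nat cannot be below its
    initial value.  Stationarity transports this to increments from any other
    time, so that increments may be treated as natural numbers. *)
Lemma increment_lt0 (t : R) : P [set w | increment N 0 t w < 0] = 0%E.
Proof.
have [Z [mZ Z0 NZ]] := N0.
apply/eqP; rewrite -measure_le0 -Z0 le_measure ?inE//.
  exact: (measurable_increment [set z | z < 0]).
move=> w /=; rewrite /increment => H; apply: NZ => /= e.
by move: H; rewrite e subr0.
Qed.

Hypothesis Nind : independent_increments N.
Hypothesis Nstat : stationary_increments N.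

Lemma increment_law (s t : R) (A : set int) : 0 <= s -> 0 <= t ->
  P [set w | A (increment N s (s + t) w)] = P [set w | A (increment N 0 t w)].
Proof. by move=> s0 t0; rewrite (Nstat A s0 (lexx 0) t0) add0r. Qed.

Lemma independent_two (s t : R) (x y : int) : 0 <= s -> 0 <= t ->
  P ([set w | increment N 0 s w = x] `&`
     [set w | increment N s (s + t) w = y]) =
  (P [set w | increment N 0 s w = x] * P [set w | increment N 0 t w = y])%E.
Proof.
move=> s0 t0.
have := Nind (n := 2)
  (t := fun n => if n is n'.+1 then if n' is 0%N then s else s + t else 0)
  (fun n => if n is 0%N then [set x] else [set y]) (lexx 0).
have le01 i : (i < 2)%N ->
   (if i is n'.+1 then if n' is 0%N then s else s + t else 0) <=
   (if i.+1 is n'.+1 then if n' is 0%N then s else s + t else 0).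
  by case: i => [|[|//]] _ //; rewrite lerDl.
move=> /(_ le01); rewrite !big_ord_recl big_ord0 mule1 /=.
rewrite -(increment_law [set y] s0 t0) => <-; congr (P _).
apply/seteqP; split => [w [/= Hx Hy] [|[|//]] //|w H].
by split; [exact: (H 0%N)|exact: (H 1%N)].
Qed.

(** A count k over [0, s + t] splits as i over [0, s] and k - i over
    [s, s + t], with 0 <= i <= k because increments are almost surely
    nonnegative. *)
Lemma count_law_semigroup : convolution_semigroup count_law.
Proof.
move=> s t k s0 t0.
pose F (i : nat) := [set w | increment N 0 s w = i%:Z] `&`
  [set w | increment N s (s + t) w = (k - i)%N%:Z].
have mF i : measurable (F i).
  by apply: measurableI; exact: (measurable_increment [set _]).
have mU : measurable (\big[setU/set0]_(i < k.+1) F i) by exact: bigsetU_measurable.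
have tF : trivIset `I_k.+1 F.
  apply/trivIsetP => i j _ _ ij; apply/seteqP; split => // w [[/= e _] [/= e' _]].
  by move: ij; move: e'; rewrite e => -[->]; rewrite eqxx.
pose Z := [set w | increment N 0 s w < 0] `|`
  [set w | increment N s (s + t) w < 0].
(* Off the null set Z, the event is the disjoint union of the F i, i <= k. *)
have m1 := measurable_increment [set z | z < 0] 0 s.
have m2 := measurable_increment [set z | z < 0] s (s + t).
have mZ : measurable Z by exact: measurableU.
have Z0 : P Z = 0%E.
  rewrite measureU0//; first exact: increment_lt0.
  by rewrite -(increment_lt0 t); exact: (increment_law [set z | z < 0] s0 t0).
apply: EFin_inj; rewrite count_lawE -sumEFin.
rewrite (@measure_eq_mod0 _ (\big[setU/set0]_(i < k.+1) F i) Z)//.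
- rewrite measure_semi_additive_ord_I//; apply: eq_bigr => i _.
  by rewrite EFinM !count_lawE; exact: independent_two.
- exact: (measurable_increment [set k%:Z]).
have incD w : increment N 0 (s + t) w =
    increment N 0 s w + increment N s (s + t) w.
  by rewrite /increment; ring.
apply/seteqP; split => w [/= H|]; try by right.
  have [x0|x0] := ltP (increment N 0 s w) 0; first by right; left.
  have [y0|y0] := ltP (increment N s (s + t) w) 0; first by right; right.
  left; rewrite -bigcup_mkord.
  move: x0 y0 H; rewrite incD.
  case ei: (increment N 0 s w) => [i|//] _.
  case ej: (increment N s (s + t) w) => [j|//] _.
  rewrite -PoszD => -[ijk]; exists i => /=; first by rewrite -ijk ltnS leq_addr.
  by split; rewrite /= ?ei ?ej -?ijk ?addKn.
move: H; rewrite -bigcup_mkord => -[i /= ik [/= ei ej]]; left.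
by rewrite /= incD ei ej -PoszD subnKC.
Qed.

End start.

(** At u = 1 the coefficients of levy_taylor are the factors of h in the
    infinitesimal description of the process, - f(lambda) and the jump rates. *)
Lemma generalized_poisson_generator (lambda : R)
    (nu : {measure set (measurableTypeR R) -> \bar R}) :
  generalized_poisson lambda nu N ->
  generator (fun k => levy_taylor nu lambda k 1) count_law.
Proof.
move=> gp k.
have H e : 0 < e -> \forall h \near 0^'+,
    `|count_law h k - ((k == 0%N)%:R + h * levy_taylor nu lambda k 1)| <= e * `|h|.
  move=> e0; case: k => [|k].
    have /eqaddoP/(_ e e0) := gp_no_jump gp (lexx 0).
    apply: filterS => h.
    by rewrite /levy_taylor mulr1 mulrN /count_law !fctE/= add0r.
  have /eqaddoP/(_ e e0) := gp_jump gp (lexx 0) (ltn0Sn k).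
  apply: filterS => h.
  by rewrite /levy_taylor mulr1 add0r /count_law !fctE/= add0r.
apply/cvgrPdist_le => e e0.
have := H e e0; apply: filter_app; near=> h.
have h0 : 0 < h by near: h; exact: nbhs_right_gt.
rewrite /= (gtr0_norm h0) => He.
rewrite distrC.
have -> : h^-1 * (count_law h k - (k == 0%N)%:R) - levy_taylor nu lambda k 1 =
  h^-1 * (count_law h k - ((k == 0%N)%:R + h * levy_taylor nu lambda k 1)).
  by field; rewrite gt_eqF.
rewrite normrM gtr0_norm ?invr_gt0// mulrC ler_pdivrMr//.
Unshelve. all: end_near. Qed.

End counting_process.

Theorem mainTheorem3 (d : measure_display) (T : measurableType d)
    (R : realType) (P : probability T R) (lambda : R)
    (nu : {measure set (measurableTypeR R) -> \bar R})
    (N : R -> {RV P >-> nat}) :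
  0 < lambda -> levy_integrable nu -> generalized_poisson lambda nu N ->
  forall (t : R) (k : nat), 0 < t ->
    let g := fun u : R => expR (- (t * bernstein nu (lambda * u))) in
    (forall j : nat, (j < k)%N ->
      \forall u \near (1 : R), derivable (derive1n j g) u 1) /\
    P [set w | N t w = k] = ((-1) ^+ k / k`!%:R * derive1n k g 1)%:E.
Proof.
move=> l0 nu_levy gp t k t0 g.
have dL := taylor_family_levy nu_levy l0.
have gE : g = fun u => expR (t * levy_taylor nu lambda 0 u).
  by apply/funext => u; rewrite /g /levy_taylor mulrN.
have dg := taylor_family_exp t dL; rewrite /= -gE in dg.
split=> [j _|].
  by near=> u; apply: (dg j u _).1; near: u; exact: lt_nbhsr.
have semi := count_law_semigroup (gp_start gp) (gp_independent gp)
  (gp_stationary gp).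
have gen := generalized_poisson_generator gp.
have q0 := count_law0 N.
rewrite (count_lawP (gp_start gp)); congr EFin; move: k.
apply: (exp_recursion_unique (semigroup_exp_recursion semi q0 gen t0)).
  by move=> k; exact: (dg k 1 ltr01).2.
rewrite (semigroup_expR semi q0 gen t0) gE derive1n0.
by rewrite expr0 fact0 divr1 mul1r.
Unshelve. all: end_near. Qed.
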